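(* Let $\mathcal{H}$ be a Hopf algebra, let $M$ be a right-left module-comodule over $\mathcal{H}$, and let $A$ be a left $\mathcal{H}$-comodule algebra. If $M$ is an $^A\mathcal{H}$-SAYD module, then $M$ is an $^A\mathcal{H}$-HCC module.
   Context: All Hopf algebras are over a ground field $k$ and have bijective antipode $S$. Coproduct: $\Delta(h)=h^{(1)}\otimes h^{(2)}$. Left coactions are written $x\mapsto x_{<-1>}\otimes x_{<0>}$. A right-left module-comodule over $\mathcal{H}$ is a vector space $M$ with a right $\mathcal{H}$-action and a left $\mathcal{H}$-coaction $m\mapsto m_{<-1>}\otimes m_{<0>}$ (no compatibility is assumed). A left $\mathcal{H}$-comodule algebra is a unital algebra $A$ with a left $\mathcal{H}$-coaction $A\to \mathcal{H}\otimes A$ that is a unital algebra map. $\mathcal{H}$ coacts on $A^{\otimes(n+1)}$ diagonally: $a_0\otimes\cdots\otimes a_n\mapsto (a_0)_{<-1>}\cdots (a_n)_{<-1>}\otimes (a_0)_{<0>}\otimes\cdots\otimes (a_n)_{<0>}$; for $\widetilde a\in A^{\otimes (n+1)}$ this is written $\widetilde a_{<-1>}\otimes\widetilde a_{<0>}$. Let $\mathrm{Hom}^{\mathcal{H}}(A^{\otimes(n+1)},M)$ denote the space of left $\mathcal{H}$-colinear maps. Definition ($^A\mathcal{H}$-SAYD). $M$ is an $^A\mathcal{H}$-SAYD module if for all $n\ge 0$ and $\varphi\in\mathrm{Hom}^{\mathcal{H}}(A^{\otimes(n+1)},M)$: (i) for all $a\in A$ and $\widetilde a=a_1\otimes\cdots\otimes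 a_n\in A^{\otimes n}$, $$(\varphi(a_{<0>}\otimes\widetilde a)a_{<-1>})_{<-1>}\otimes(\varphi(a_{<0>}\otimes\widetilde a)a_{<-1>})_{<0>}=S(a_{<-1>}^{(3)})\,\varphi(a_{<0>}\otimes\widetilde a)_{<-1>}\,a_{<-1>}^{(1)}\otimes\varphi(a_{<0>}\otimes\widetilde a)_{<0>}\,a_{<-1>}^{(2)};$$ (ii) $\varphi(\widetilde a_{<0>})\,\widetilde a_{<-1>}=\varphi(\widetilde a)$ for all $\widetilde a\in A^{\otimes(n+1)}$. Definition ($^A\mathcal{H}$-HCC, Hopf cyclic coefficients). $M$ is an $^A\mathcal{H}$-HCC module if the following operators are well defined on the spaces $C^n=\mathrm{Hom}^{\mathcal{H}}(A^{\otimes(n+1)},M)$, $n\ge0$ (i.e. send colinear maps to colinear maps), and make $\{C^n\}_{n\ge0}$ a cocyclic module: cofaces $\delta_i:C^{n-1}\to C^n$, $(\delta_if)(a_0\otimes\cdots\otimes a_n)=f(a_0\otimes\cdots\otimes a_ia_{i+1}\otimes\cdots\otimes a_n)$ for $0\le i<n$, and $(\delta_nf)(a_0\otimes\cdots\otimes a_n)=f((a_n)_{<0>}a_0\otimes a_1\otimes\cdots\otimes a_{n-1})\,(a_n)_{<-1>}$; codegeneracies $\sigma_i:C^{n+1}\to C^n$, $(\sigma_if)(a_0\otimes\cdots\otimes a_n)=f(a_0\otimes\cdots\otimes a_i\otimes1\otimes a_{i+1}\otimes\cdots\otimes a_n)$ for $0\le i\le n$; cyclic operator $\tau_n:C^n\to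 C^n$, $(\tau_nf)(a_0\otimes\cdots\otimes a_n)=f((a_n)_{<0>}\otimes a_0\otimes\cdots\otimes a_{n-1})\,(a_n)_{<-1>}$. *)

(* Defs.v *)
From HB Require Import structures.
From mathcomp Require Import all_boot all_algebra.
From mathcomp Require Import boolp functions.

Set Implicit Arguments.
Unset Strict Implicit.
Unset Printing Implicit Defensive.

Import GRing.Theory.
Local Open Scope ring_scope.
Local Open Scope quotient_scope.

(* The k-vector space generated by symbols [gen x], x : X, that is universal   *)
(* for the maps out of X satisfying P (below: bilinear, resp. multilinear      *)
(* maps).  It is the quotient of the formal sums \sum_i c_i x_i by the         *)
(* identities that every map satisfying P validates; [uext_gen], [uext_linear] *)
(* and [uext_unique] are its universal property.                               *)
Section UniversalModule.
Variables (k : fieldType) (X : choiceType).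
Variable P : forall W : lmodType k, (X -> W) -> Prop.

Definition fsum (W : lmodType k) (f : X -> W) (s : seq (k * X)) : W :=
  \sum_(p <- s) p.1 *: f p.2.

Lemma fsum_cat (W : lmodType k) (f : X -> W) s t :
  fsum f (s ++ t) = fsum f s + fsum f t.
Proof. by rewrite /fsum big_cat. Qed.

Definition fscale (c : k) (s : seq (k * X)) := [seq (c * p.1, p.2) | p <- s].

Lemma fsum_scale (W : lmodType k) (f : X -> W) c s :
  fsum f (fscale c s) = c *: fsum f s.
Proof.
rewrite /fsum /fscale big_map scaler_sumr.
by apply: eq_bigr => p _; rewrite scalerA.
Qed.

Lemma fsum1 (W : lmodType k) (f : X -> W) x : fsum f [:: (1, x)] = f x.
Proof. by rewrite /fsum big_seq1 scale1r. Qed.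

Lemma fsum_lin (W V : lmodType k) (f : X -> W) (h : W -> V) s :
  linear h -> h (fsum f s) = fsum (h \o f) s.
Proof.
move=> hl; have h0 : h 0 = 0 by rewrite -(subrr 0) (zmod_morphism_linear hl) subrr.
rewrite /fsum; elim: s => [|p s IHs]; first by rewrite !big_nil.
by rewrite !big_cons hl IHs.
Qed.

Definition feqv (s t : seq (k * X)) : bool :=
  `[< forall (W : lmodType k) (f : X -> W), P f -> fsum f s = fsum f t >].

Lemma feqv_refl : reflexive feqv.
Proof. by move=> s; apply/asboolP. Qed.

Lemma feqv_sym : symmetric feqv.
Proof.
by move=> s t; apply/asboolP/asboolP => st W f Pf; rewrite (st _ _ Pf).
Qed.

Lemma feqv_trans : transitive feqv.
Proof.
move=> t s u /asboolP st /asboolP tu; apply/asboolP => W f Pf.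
by rewrite (st _ _ Pf) (tu _ _ Pf).
Qed.

Canonical feqv_equiv := EquivRel feqv feqv_refl feqv_sym feqv_trans.

Definition umod := {eq_quot feqv}.
HB.instance Definition _ := Choice.on umod.
HB.instance Definition _ := EqQuotient.on umod.

Lemma umodP s t :
  reflect (forall (W : lmodType k) (f : X -> W), P f -> fsum f s = fsum f t)
          (\pi_umod s == \pi_umod t).
Proof. by rewrite eqmodE; apply: asboolP. Qed.

Lemma fsum_repr (W : lmodType k) (f : X -> W) s :
  P f -> fsum f (repr (\pi_umod s)) = fsum f s.
Proof. by move=> Pf; have /eqP/umodP := reprK (\pi_umod s); exact. Qed.

Definition uzero : umod := \pi_umod [::].
Definition uadd (x y : umod) : umod := \pi_umod (repr x ++ repr y).
Definition uscale (c : k) (x : umod) : umod := \pi_umod (fscale c (repr x)).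
Definition uopp (x : umod) : umod := uscale (-1) x.

Lemma umod_eq (x y : umod) :
  (forall (W : lmodType k) (f : X -> W), P f ->
     fsum f (repr x) = fsum f (repr y)) -> x = y.
Proof. by rewrite -[x]reprK -[y]reprK => H; apply/eqP/umodP=> W f Pf;
  rewrite -(fsum_repr _ Pf) H // fsum_repr. Qed.

Let ureprE (W : lmodType k) (f : X -> W) (Pf : P f) :=
  (fun s => fsum_repr s Pf, fsum_cat f, fsum_scale f).

Lemma uaddA : associative uadd.
Proof. by move=> x y z; apply: umod_eq => W f Pf; rewrite !(ureprE Pf) addrA. Qed.
Lemma uaddC : commutative uadd.
Proof. by move=> x y; apply: umod_eq => W f Pf; rewrite !(ureprE Pf) addrC. Qed.
Lemma uadd0 : left_id uzero uadd.
Proof.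
move=> x; apply: umod_eq => W f Pf; rewrite !(ureprE Pf).
by rewrite [fsum f [::]]big_nil add0r.
Qed.
Lemma uaddN : left_inverse uzero uopp uadd.
Proof.
move=> x; apply: umod_eq => W f Pf; rewrite !(ureprE Pf).
by rewrite [fsum f [::]]big_nil scaleN1r addNr.
Qed.
HB.instance Definition _ := GRing.isZmodule.Build umod uaddA uaddC uadd0 uaddN.

Lemma uscaleA a b x : uscale a (uscale b x) = uscale (a * b) x.
Proof. by apply: umod_eq => W f Pf; rewrite !(ureprE Pf) scalerA. Qed.
Lemma uscale1 : left_id 1 uscale.
Proof. by move=> x; apply: umod_eq => W f Pf; rewrite !(ureprE Pf) scale1r. Qed.
Lemma uscaleDr : right_distributive uscale +%R.
Proof.
by move=> a x y; apply: umod_eq => W f Pf; rewrite !(ureprE Pf) scalerDr.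
Qed.
Lemma uscaleDl x : {morph uscale^~ x : a b / a + b}.
Proof.
by move=> a b; apply: umod_eq => W f Pf; rewrite !(ureprE Pf) scalerDl.
Qed.
HB.instance Definition _ :=
  GRing.Zmodule_isLmodule.Build k umod uscaleA uscale1 uscaleDr uscaleDl.

Definition gen (x : X) : umod := \pi_umod [:: (1, x)].

(* For f not satisfying P the value depends on a chosen representative; [uext] *)
(* is only meant for maps satisfying P.                                        *)
Definition uext (W : lmodType k) (f : X -> W) (t : umod) : W := fsum f (repr t).

Lemma uext_linear (W : lmodType k) (f : X -> W) : P f -> linear (uext f).
Proof. by move=> Pf c x y; rewrite /uext !(ureprE Pf). Qed.

Lemma uext_gen (W : lmodType k) (f : X -> W) x : P f -> uext f (gen x) = f x.
Proof. by move=> Pf; rewrite /uext fsum_repr // fsum1. Qed.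

Lemma fsum_gen s : fsum gen s = \pi_umod s.
Proof.
apply: umod_eq => W f Pf; rewrite -/(uext f _) (fsum_lin _ _ (uext_linear Pf)).
by rewrite fsum_repr //; apply: eq_bigr => p _ /=; rewrite uext_gen.
Qed.

Lemma umod_span (t : umod) : t = fsum gen (repr t).
Proof. by rewrite fsum_gen reprK. Qed.

Lemma uext_unique (W : lmodType k) (g h : umod -> W) :
  linear g -> linear h -> (forall x, g (gen x) = h (gen x)) -> g =1 h.
Proof.
move=> gl hl gh t; rewrite (umod_span t) !fsum_lin //.
by apply: eq_bigr => p _ /=; rewrite gh.
Qed.

Lemma gen_rel s t :
  (forall (W : lmodType k) (f : X -> W), P f -> fsum f s = fsum f t) ->
  fsum gen s = fsum gen t.
Proof. by move=> st; rewrite !fsum_gen; apply/eqP/umodP. Qed.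

End UniversalModule.

Section Tensor.
Variable k : fieldType.

Definition pair_bilinear (U V W : lmodType k) (f : U * V -> W) : Prop :=
  (forall v, linear (fun u => f (u, v))) /\
  (forall u, linear (fun v => f (u, v))).

Definition tensor (U V : lmodType k) : lmodType k :=
  umod (@pair_bilinear U V).

Definition tens (U V : lmodType k) (u : U) (v : V) : tensor U V :=
  gen (@pair_bilinear U V) (u, v).

Lemma tens_linearl (U V : lmodType k) (v : V) :
  linear (fun u : U => tens u v).
Proof.
move=> c x y; have := @gen_rel _ _ (@pair_bilinear U V)
  [:: (1, (c *: x + y, v))] [:: (c, (x, v)); (1, (y, v))].
rewrite /fsum !big_cons !big_nil /= !scale1r !addr0; apply => W f [fl _].
by rewrite !big_cons !big_nil /= !scale1r !addr0 (fl v).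
Qed.

Lemma tens_linearr (U V : lmodType k) (u : U) :
  linear (fun v : V => tens u v).
Proof.
move=> c x y; have := @gen_rel _ _ (@pair_bilinear U V)
  [:: (1, (u, c *: x + y))] [:: (c, (u, x)); (1, (u, y))].
rewrite /fsum !big_cons !big_nil /= !scale1r !addr0; apply => W f [_ fl].
by rewrite !big_cons !big_nil /= !scale1r !addr0 (fl u).
Qed.

Lemma tens0r (U V : lmodType k) (u : U) : tens u (0 : V) = 0.
Proof.
by rewrite -(subrr (0 : V)) (zmod_morphism_linear (tens_linearr u)) subrr.
Qed.

(* Sweedler's notation: if t = \sum_i c_i (u_i (x) v_i), then                  *)
(* [sweedler t f] = \sum_i c_i f u_i v_i.  It is independent of the            *)
(* decomposition of t when f is bilinear, and only used for such f.            *)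
Definition sweedler (U V W : lmodType k) (t : tensor U V) (f : U -> V -> W) : W :=
  uext (fun p => f p.1 p.2) t.

Lemma sweedler_tens (U V W : lmodType k) (f : U -> V -> W) u v :
  pair_bilinear (fun p => f p.1 p.2) -> sweedler (tens u v) f = f u v.
Proof. by move=> fb; rewrite /sweedler uext_gen. Qed.

Lemma sweedler_linear (U V W : lmodType k) (f : U -> V -> W) :
  pair_bilinear (fun p => f p.1 p.2) -> linear (fun t => sweedler t f).
Proof. by move=> fb; apply: uext_linear. Qed.

Lemma sweedler_body (U V W : lmodType k) (t : tensor U V) (f g : U -> V -> W) c :
  sweedler t (fun u v => c *: f u v + g u v) = c *: sweedler t f + sweedler t g.
Proof.
rewrite /sweedler /uext /fsum scaler_sumr -big_split; apply: eq_bigr => p _ /=.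
by rewrite scalerDr !scalerA [c * _]mulrC.
Qed.

Lemma eq_sweedler (U V W : lmodType k) (t : tensor U V) (f g : U -> V -> W) :
  (forall u v, f u v = g u v) -> sweedler t f = sweedler t g.
Proof. by move=> fg; apply: eq_bigr => p _ /=; rewrite fg. Qed.

End Tensor.

Notation "u ⊗ v" := (tens u v) (at level 38, left associativity) : ring_scope.
Notation "'\sw_' ( x , y <- t ) E" := (sweedler t (fun x y => E))
  (at level 41, E at level 41, x name, y name, t at level 50,
   format "'\sw_' ( x ,  y  <-  t )  E") : ring_scope.

Section TensorPower.
Variables (k : fieldType) (A : lmodType k) (n : nat).

Definition tuple_upd (t : n.-tuple A) (i : 'I_n) (a : A) : n.-tuple A :=
  [tuple if j == i then a else tnth t j | j < n].

Definition multilinear (W : lmodType k) (f : n.-tuple A -> W) : Prop :=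
  forall (t : n.-tuple A) (i : 'I_n), linear (fun a => f (tuple_upd t i a)).

(* A^{(x) n}; every map on the unique 0-tuple is multilinear, so that          *)
(* A^{(x) 0} is one-dimensional.                                               *)
Definition tpow : lmodType k := umod multilinear.

Definition pure (t : n.-tuple A) : tpow := gen multilinear t.

Lemma pure_multilinear : multilinear pure.
Proof.
move=> t i c x y; have := @gen_rel _ _ multilinear
  [:: (1, tuple_upd t i (c *: x + y))]
  [:: (c, tuple_upd t i x); (1, tuple_upd t i y)].
rewrite /fsum !big_cons !big_nil /= !scale1r !addr0; apply => W f fl.
by rewrite !big_cons !big_nil /= !scale1r !addr0 (fl t i).
Qed.

End TensorPower.

Section Hopf.
Variable k : fieldType.

(* Coassociativity is stated in C (x) (C (x) V). *)
Definition coassociative (C V : lmodType k)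
    (Delta : C -> tensor C C) (rho : V -> tensor C V) : Prop :=
  forall x, \sw_(h, v <- rho x) \sw_(h1, h2 <- Delta h) h1 ⊗ (h2 ⊗ v)
            = \sw_(h, v <- rho x) h ⊗ rho v.

Record hopf_algebra := HopfAlgebra {
  hopf_sort :> algType k;
  comul : {linear hopf_sort -> tensor hopf_sort hopf_sort};
  counit : {linear hopf_sort -> k^o};
  antipode : {linear hopf_sort -> hopf_sort};
  comul_coassoc : coassociative comul comul;
  comul_counitl : forall h, \sw_(h1, h2 <- comul h) counit h1 *: h2 = h;
  comul_counitr : forall h, \sw_(h1, h2 <- comul h) counit h2 *: h1 = h;
  comul1 : comul 1 = 1 ⊗ 1;
  comulM : forall g h, comul (g * h) =
    \sw_(g1, g2 <- comul g) \sw_(h1, h2 <- comul h) (g1 * h1) ⊗ (g2 * h2);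
  counit1 : counit 1 = 1;
  counitM : forall g h, counit (g * h) = counit g * counit h;
  antipodel : forall h, \sw_(h1, h2 <- comul h) antipode h1 * h2 = (counit h)%:A;
  antipoder : forall h, \sw_(h1, h2 <- comul h) h1 * antipode h2 = (counit h)%:A;
  antipode_bij : bijective antipode
}.

Arguments comul {_}.
Arguments counit {_}.
Arguments antipode {_}.

Definition is_left_coaction (H : hopf_algebra) (V : lmodType k)
    (rho : V -> tensor H V) : Prop :=
  [/\ linear rho, coassociative comul rho
    & forall x, \sw_(h, v <- rho x) counit h *: v = x].

Record module_comodule (H : hopf_algebra) := ModuleComodule {
  mc_sort :> lmodType k;
  act : {bilinear mc_sort -> H -> mc_sort};
  act1 : forall m, act m 1 = m;
  actM : forall m g h, act m (g * h) = act (act m g) h;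
  mcoact : mc_sort -> tensor H mc_sort;
  mcoactP : is_left_coaction mcoact
}.

Record comodule_algebra (H : hopf_algebra) := ComoduleAlgebra {
  ca_sort :> algType k;
  acoact : ca_sort -> tensor H ca_sort;
  acoactP : is_left_coaction acoact;
  acoact1 : acoact 1 = 1 ⊗ 1;
  acoactM : forall a b, acoact (a * b) =
    \sw_(g, a0 <- acoact a) \sw_(h, b0 <- acoact b) (g * h) ⊗ (a0 * b0)
}.

Definition colinear (H V W : lmodType k) (rhoV : V -> tensor H V)
    (rhoW : W -> tensor H W) (f : V -> W) : Prop :=
  forall x, rhoW (f x) = \sw_(h, v <- rhoV x) h ⊗ f v.

End Hopf.

Arguments comul {_ _}.
Arguments counit {_ _}.
Arguments antipode {_ _}.
Arguments act {_ _ _}.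

Notation "m ◁ h" := (act m h) (at level 40, left associativity) : ring_scope.

Section DiagonalCoaction.
Variables (k : fieldType) (H : hopf_algebra k) (A : comodule_algebra H).

(* The iterated Sweedler sum over the coactions of all the entries of t:       *)
(* K applied to the product of their <-1>-parts and the tuple of their         *)
(* <0>-parts.                                                                  *)
Fixpoint diag_sweedler (W : lmodType k) (n : nat) :
    n.-tuple A -> (H -> n.-tuple A -> W) -> W :=
  match n with
  | 0 => fun t K => K 1 t
  | n'.+1 => fun t K => \sw_(h, a <- acoact (thead t))
      diag_sweedler (behead_tuple t) (fun g s => K (h * g) (cons_tuple a s))
  end.

Definition tcoact (n : nat) : tpow A n -> tensor H (tpow A n) :=
  uext (fun t => diag_sweedler t (fun h s => h ⊗ pure s)).

Lemma diag_sweedler_body (W : lmodType k) n (t : n.-tuple A)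
    (K1 K2 : H -> n.-tuple A -> W) c :
  diag_sweedler t (fun h s => c *: K1 h s + K2 h s) =
  c *: diag_sweedler t K1 + diag_sweedler t K2.
Proof.
elim: n t K1 K2 => [|n IHn] t K1 K2 //=.
by rewrite -sweedler_body; apply: eq_sweedler => h a; rewrite IHn.
Qed.

Lemma eq_diag_sweedler (W : lmodType k) n (t : n.-tuple A)
    (K1 K2 : H -> n.-tuple A -> W) :
  (forall h s, K1 h s = K2 h s) -> diag_sweedler t K1 = diag_sweedler t K2.
Proof.
elim: n t K1 K2 => [|n IHn] t K1 K2 K12 //=.
by apply: eq_sweedler => h a; apply: IHn => g s.
Qed.

Lemma cons_tuple_upd n (s : n.-tuple A) i a x :
  cons_tuple a (tuple_upd s i x) = tuple_upd (cons_tuple a s) (lift ord0 i) x.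
Proof.
apply: eq_from_tnth => j; rewrite !tnth_mktuple.
case: (unliftP ord0 j) => [j'|] -> /=; last by rewrite !tnth0.
by rewrite !tnthS tnth_mktuple (inj_eq lift_inj).
Qed.

Lemma tuple_upd0 n (s : n.-tuple A) a x :
  tuple_upd (cons_tuple a s) ord0 x = cons_tuple x s.
Proof.
apply: eq_from_tnth => j; rewrite !tnth_mktuple.
case: (unliftP ord0 j) => [j'|] -> /=; last by rewrite tnth0.
by rewrite !tnthS.
Qed.

Lemma diag_sweedler_multilinear (W : lmodType k) n (K : H -> n.-tuple A -> W) :
  (forall s, linear (K^~ s)) -> (forall h, multilinear (K h)) ->
  multilinear (fun t => diag_sweedler t K).
Proof.
elim: n K => [|n IHn] K Kl Km t i; first by case: i.
have bil s : pair_bilinear (fun p : H * A =>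
    diag_sweedler s (fun g s => K (p.1 * g) (cons_tuple p.2 s))).
  split=> [a|h] c x y /=; rewrite -diag_sweedler_body; apply: eq_diag_sweedler.
    by move=> h s'; rewrite mulrDl -scalerAl Kl.
  by move=> g s'; have := Km (h * g) (cons_tuple y s') ord0 c x y;
    rewrite !tuple_upd0.
case: (tupleP t) => a s; case: (unliftP ord0 i) => [j|] -> c x y /=.
  rewrite -!cons_tuple_upd !theadE -sweedler_body; apply: eq_sweedler => h b.
  have bE z : behead_tuple (cons_tuple a (tuple_upd s j z)) = tuple_upd s j z.
    by apply: eq_from_tnth => l; rewrite !(tnth_nth 0).
  rewrite !bE; apply: (IHn (fun g s => K (h * g) (cons_tuple b s))).
    by move=> s' d g g'; rewrite mulrDr -scalerAr Kl.
  by move=> g s' l d u v; rewrite !cons_tuple_upd Km.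
have bE z : behead_tuple (cons_tuple z s) = s.
  by apply: eq_from_tnth => j; rewrite !(tnth_nth 0).
have [rl _ _] := acoactP A.
rewrite !tuple_upd0 !theadE !bE rl; exact: (sweedler_linear (bil s)).
Qed.

Lemma tcoact_body n :
  multilinear (fun t : n.-tuple A => diag_sweedler t (fun h s => h ⊗ pure s)).
Proof.
apply: diag_sweedler_multilinear => [s|h t i] c x y; first exact: tens_linearl.
by rewrite pure_multilinear tens_linearr.
Qed.

Lemma tcoact_linear n : linear (@tcoact n).
Proof. exact/uext_linear/tcoact_body. Qed.

Lemma tcoact_pure n (t : n.-tuple A) :
  tcoact (pure t) = diag_sweedler t (fun h s => h ⊗ pure s).
Proof. exact/uext_gen/tcoact_body. Qed.

End DiagonalCoaction.

Section HomH.
Variables (k : fieldType) (H : hopf_algebra k).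
Variables (A : comodule_algebra H) (M : module_comodule H) (n : nat).

Definition hom_pred : pred (tpow A n.+1 -> M) :=
  fun f => `[< linear f /\ colinear (@tcoact _ H A n.+1) (@mcoact _ H M) f >].

Lemma hom_pred_closed : submod_closed hom_pred.
Proof.
have [rl _ _] := mcoactP M; split.
  apply/asboolP; split=> [c x y|x] /=; first by rewrite scaler0 addr0.
  have -> : mcoact (0 : M) = 0.
    by rewrite -(subrr 0) (zmod_morphism_linear rl) subrr.
  rewrite /sweedler /uext /fsum big1 // => p _.
  by rewrite [_ ⊗ _]tens0r scaler0.
move=> c f g /asboolP[fl fc] /asboolP[gl gc]; apply/asboolP.
have fgE z : (c *: f + g) z = c *: f z + g z by [].
split=> [d x y|x].
  rewrite !fgE fl gl !scalerDr !scalerA [c * d]mulrC.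
  by rewrite addrACA.
rewrite fgE rl fc gc -sweedler_body; apply: eq_sweedler => h y.
by rewrite fgE tens_linearr.
Qed.

HB.instance Definition _ :=
  GRing.isSubmodClosed.Build k (tpow A n.+1 -> M) hom_pred hom_pred_closed.

(* Hom^H(A^{(x) (n+1)}, M) *)
Definition homH := {f : tpow A n.+1 -> M | hom_pred f}.
HB.instance Definition _ := SubChoice.on homH.
HB.instance Definition _ := [SubChoice_isSubLmodule of homH by <:].

End HomH.

Section CocyclicModule.
Variables (k : fieldType) (C : nat -> lmodType k).

(* delta n i is the i-th coface C^n -> C^{n+1} (meaningful for i <= n+1),      *)
(* sigma n i the i-th codegeneracy C^{n+1} -> C^n (meaningful for i <= n).     *)
Record cocyclic_module := CocyclicModule {
  delta : forall n, nat -> {linear C n -> C n.+1};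
  sigma : forall n, nat -> {linear C n.+1 -> C n};
  tau : forall n, {linear C n -> C n};
  delta_delta : forall n i j f, (i < j <= n.+2)%N ->
    delta n.+1 j (delta n i f) = delta n.+1 i (delta n j.-1 f);
  sigma_sigma : forall n i j f, (i <= j <= n)%N ->
    sigma n j (sigma n.+1 i f) = sigma n i (sigma n.+1 j.+1 f);
  sigma_delta_lt : forall n i j f, (i < j <= n.+1)%N ->
    sigma n.+1 j (delta n.+1 i f) = delta n i (sigma n j.-1 f);
  sigma_delta_id : forall n i j f, (j <= n)%N -> i = j \/ i = j.+1 ->
    sigma n j (delta n i f) = f;
  sigma_delta_gt : forall n i j f, (j.+1 < i <= n.+2)%N ->
    sigma n.+1 j (delta n.+1 i f) = delta n i.-1 (sigma n j f);
  tau_delta0 : forall n f, tau n.+1 (delta n 0 f) = delta n n.+1 f;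
  tau_delta : forall n i f, (0 < i <= n.+1)%N ->
    tau n.+1 (delta n i f) = delta n i.-1 (tau n f);
  tau_sigma0 : forall n f,
    tau n (sigma n 0 f) = sigma n n (tau n.+1 (tau n.+1 f));
  tau_sigma : forall n i f, (0 < i <= n)%N ->
    tau n (sigma n i f) = sigma n i.-1 (tau n.+1 f);
  tau_cyclic : forall n f, iter n.+1 (tau n) f = f
}.

End CocyclicModule.

Section Coefficients.
Variables (k : fieldType) (H : hopf_algebra k).
Variables (A : comodule_algebra H) (M : module_comodule H).

Definition SAYD : Prop := forall (n : nat) (phi : homH A M n),
  (forall (a : A) (t : n.-tuple A),
     mcoact (\sw_(h, a0 <- acoact a) (val phi (pure (cons_tuple a0 t)) ◁ h)) =
     \sw_(h, a0 <- acoact a) \sw_(h1, h' <- comul h) \sw_(h2, h3 <- comul h')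
       \sw_(g, m <- mcoact (val phi (pure (cons_tuple a0 t))))
         (antipode h3 * g * h1) ⊗ (m ◁ h2)) /\
  (forall x : tpow A n.+1, \sw_(h, y <- tcoact x) (val phi y ◁ h) = val phi x).

(* Below t is (a_0, ..., a_n) and t`_i = a_i; "mul_at i" multiplies the i-th   *)
(* and (i+1)-st entries, "insert1 i" inserts 1 after the i-th entry.           *)
Definition mul_at n (i : nat) (t : n.+1.-tuple A) : n.-tuple A :=
  [tuple if (j < i)%N then t`_j
         else if j == i :> nat then t`_i * t`_i.+1 else t`_j.+1 | j < n].

Definition mul_front n (b : A) (t : n.+2.-tuple A) : n.+1.-tuple A :=
  [tuple if j == 0 :> nat then b * t`_0 else t`_j | j < n.+1].

Definition insert1 n (i : nat) (t : n.-tuple A) : n.+1.-tuple A :=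
  [tuple if (j <= i)%N then t`_j
         else if j == i.+1 :> nat then 1 else t`_j.-1 | j < n.+1].

Definition rotate n (b : A) (t : n.+1.-tuple A) : n.+1.-tuple A :=
  [tuple if j == 0 :> nat then b else t`_j.-1 | j < n.+1].

Definition HCC : Prop := exists C : cocyclic_module (homH A M),
  [/\ forall n i f (t : n.+2.-tuple A), (i <= n)%N ->
        val (delta C n i f) (pure t) = val f (pure (mul_at i t)),
      forall n f (t : n.+2.-tuple A),
        val (delta C n n.+1 f) (pure t) =
        \sw_(h, b <- acoact t`_n.+1) (val f (pure (mul_front b t)) ◁ h),
      forall n i f (t : n.+1.-tuple A), (i <= n)%N ->
        val (sigma C n i f) (pure t) = val f (pure (insert1 i t))
    & forall n f (t : n.+1.-tuple A),
        val (tau C n f) (pure t) =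
        \sw_(h, b <- acoact t`_n) (val f (pure (rotate b t)) ◁ h)].

End Coefficients.

(* Main.v *)
(* The cofaces delta_i with i <= n and the codegeneracies are precompositions  *)
(* with multiplications and insertions of 1, which are colinear because A is a *)
(* comodule algebra.  The only operator that does not obviously preserve       *)
(* colinearity is tau: expanding the coaction of phi(b_(0) ⊗ t) b_(-1) by      *)
(* condition (i) and colinearity of phi gives                                  *)
(*   S(b_(-1)^(3)) b_(0)(-1) t_(-1) b_(-1)^(1)                                 *)
(*     ⊗ phi(b_(0)(0) ⊗ t_(0)) b_(-1)^(2),                                     *)
(* and the antipode cancels the first two factors.  The last coface is         *)
(* tau delta_0, so that the relations involving it follow formally from the    *)
(* others.  Finally tau^(n+1) phi (x) = phi(x_(0)) x_(-1), which is phi(x) by  *)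
(* condition (ii).                                                             *)
Require Import Defs.
From HB Require Import structures.
From mathcomp Require Import all_boot all_algebra.
From mathcomp Require Import boolp functions zify.

Set Implicit Arguments.
Unset Strict Implicit.
Unset Printing Implicit Defensive.

Import GRing.Theory.
Local Open Scope ring_scope.

(** Condition (i) makes [tau] preserve colinearity ([tau_fun_hom]). Three uses of coassociativity
    recognise the factor [S(b_(-1)^(3)) b_(0)(-1)] as the antipode axiom applied to a single leg, so
    it collapses to the unit ([sweedler_antipode_cancel]); what remains is the diagonal coaction of
    [s ⊗ b] followed by [tau]. Condition (ii) gives cyclicity: every application of [tau] brings the
    last entry to the front and acts by its leg, so after n+1 steps all legs act, multiplied in the
    order of the diagonal coaction ([iter_tau_hom], [tau_hom_cyclic]).

    The untwisted cofaces and the codegeneracies are precompositions ([subst_hom]), and their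
    relations are identities between maps of tuples. The relations with [tau] are checked on tuples
    [rcons_tuple s b]; the substantial one is [tau_tau_coface0], which rests on the multiplicativity
    of the coaction and the associativity of the action. Relations with the last coface, being tau
    delta_0, reduce to these and to the triviality of the coaction on 1. *)

(** * Linearity and exchange rules for Sweedler sums *)

Section Linearity.
Variable k : fieldType.
Implicit Types U V W X : lmodType k.

Lemma linear_tensl U V W (v : V) (f : W -> U) :
  linear f -> linear (fun x => f x ⊗ v).
Proof. by move=> fl c x y; rewrite fl; exact: tens_linearl. Qed.

Lemma linear_tensr U V W (u : U) (f : W -> V) :
  linear f -> linear (fun x => u ⊗ f x).
Proof. by move=> fl c x y; rewrite fl; exact: tens_linearr. Qed.

Lemma linear_mull (R : algType k) W (f : W -> R) (r : R) :
  linear f -> linear (fun x => f x * r).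
Proof. by move=> fl c x y; rewrite fl mulrDl scalerAl. Qed.

Lemma linear_mulr (R : algType k) W (f : W -> R) (r : R) :
  linear f -> linear (fun x => r * f x).
Proof. by move=> fl c x y; rewrite fl mulrDr scalerAr. Qed.

Lemma linear_lapp V W X (g : {linear V -> W}) (f : X -> V) :
  linear f -> linear (fun x => g (f x)).
Proof. by move=> fl c x y; rewrite fl linearP. Qed.

Lemma linear_sweedler_body U V W X (t : tensor U V) (F : X -> U -> V -> W) :
  (forall u v, linear (fun x => F x u v)) -> linear (fun x => sweedler t (F x)).
Proof.
move=> Fl c x y; rewrite -sweedler_body.
by apply: eq_sweedler => u v; rewrite Fl.
Qed.

Lemma linear_sweedler_arg U V W X (t : X -> tensor U V) (F : U -> V -> W) :
  linear t -> pair_bilinear (fun p => F p.1 p.2) ->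
  linear (fun x => sweedler (t x) F).
Proof. by move=> tl Fb c x y; rewrite tl; exact: sweedler_linear. Qed.

(** [sweedler] is a finite sum over a chosen representative of [t], so [L] passes through it
    termwise. *)
Lemma linear_sweedler U V W W' (L : W -> W') (t : tensor U V)
    (F : U -> V -> W) :
  linear L -> L (sweedler t F) = sweedler t (fun u v => L (F u v)).
Proof. by move=> Ll; rewrite /sweedler /uext fsum_lin. Qed.

Lemma exchange_sweedler U V U' V' W (t : tensor U V) (t' : tensor U' V')
    (F : U -> V -> U' -> V' -> W) :
  \sw_(u, v <- t) \sw_(u', v' <- t') F u v u' v' =
  \sw_(u', v' <- t') \sw_(u, v <- t) F u v u' v'.
Proof.
rewrite /sweedler /uext /fsum.
under eq_bigr do rewrite scaler_sumr.
rewrite exchange_big; apply: eq_bigr => q _; rewrite scaler_sumr.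
by apply: eq_bigr => p _; rewrite !scalerA mulrC.
Qed.

(** A trilinear [F] induces a linear map on [C ⊗ (C ⊗ V)], where [coassociative] is stated; this map
    is applied to both sides. *)
Lemma sweedler_coassoc (C V W : lmodType k) (Delta : C -> tensor C C)
    (rho : V -> tensor C V) x (F : C -> C -> V -> W) :
  coassociative Delta rho -> linear rho ->
  (forall h v, linear (fun g => F g h v)) ->
  (forall g v, linear (fun h => F g h v)) ->
  (forall g h, linear (F g h)) ->
  \sw_(h, v <- rho x) \sw_(h1, h2 <- Delta h) F h1 h2 v =
  \sw_(h, v <- rho x) \sw_(g, w <- rho v) F h g w.
Proof.
move=> /(_ x) coassoc rhol F1 F2 F3.
pose E h t := sweedler t (F h).
have Fb h : pair_bilinear (fun p => F h p.1 p.2).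
  by split=> [v|g]; [exact: F2 | exact: F3].
have Eb : pair_bilinear (fun p => E p.1 p.2).
  split=> [t|h]; last exact: (sweedler_linear (Fb h)).
  by apply: linear_sweedler_body => u v; exact: F1.
have Ll : linear (fun t => sweedler t E) by exact: (sweedler_linear Eb).
have := congr1 (fun t => sweedler t E) coassoc.
rewrite /= !(linear_sweedler _ _ Ll).
under eq_sweedler => h v.
  rewrite (linear_sweedler _ _ Ll).
  under eq_sweedler => h1 h2 do rewrite sweedler_tens // /E sweedler_tens //.
  over.
by move=> ->; apply: eq_sweedler => h v; rewrite sweedler_tens.
Qed.

End Linearity.

(** * Linearity of coactions, actions and cochains *)

Section Structure.
Variables (k : fieldType) (H : hopf_algebra k).
Variables (A : comodule_algebra H) (M : module_comodule H).

Lemma acoact_linear : linear (@acoact _ H A).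
Proof. by have [] := acoactP A. Qed.
HB.instance Definition _ :=
  GRing.isLinear.Build k A (tensor H A) *:%R (@acoact _ H A) acoact_linear.

Lemma mcoact_linear : linear (@mcoact _ H M).
Proof. by have [] := mcoactP M. Qed.
HB.instance Definition _ :=
  GRing.isLinear.Build k M (tensor H M) *:%R (@mcoact _ H M) mcoact_linear.

Lemma linear_actl (W : lmodType k) (f : W -> M) (h : H) :
  linear f -> linear (fun x => f x ◁ h).
Proof. by move=> fl c x y; rewrite fl; exact: linearPl. Qed.

Lemma linear_pure_cons (W : lmodType k) n (f : W -> A) (s : n.-tuple A) :
  linear f -> linear (fun x => pure (cons_tuple (f x) s)).
Proof.
move=> fl c x y; rewrite fl.
by have := pure_multilinear (cons_tuple 0 s) ord0 c (f x) (f y);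
  rewrite /= !tuple_upd0.
Qed.

Variable n : nat.

Lemma homH_linear (f : homH A M n) : linear (val f).
Proof. by have /asboolP[] := valP f. Qed.

Lemma linear_homH (f : homH A M n) (W : lmodType k) (g : W -> tpow A n.+1) :
  linear g -> linear (fun x => val f (g x)).
Proof. by move=> gl c x y; rewrite gl homH_linear. Qed.

Lemma homH_colinear (f : homH A M n) :
  colinear (@tcoact _ H A n.+1) (@mcoact _ H M) (val f).
Proof. by have /asboolP[] := valP f. Qed.

End Structure.

(* [linear_lapp] must come last: it also applies with [idfun], which leaves the *)
(* goal unchanged.                                                             *)
Ltac solve_linear := repeat (
  intros; cbn beta iota delta [fst snd]; match goal with
  | |- pair_bilinear _ => split
  | |- GRing.linear_for _ _ => first
    [ apply: linear_tensl | apply: linear_tensr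
    | apply: linear_mull | apply: linear_mulr | apply: linear_actl
    | apply: linear_pure_cons | apply: linear_homH
    | apply: linear_sweedler_body
    | apply: linear_sweedler_arg
    | match goal with hyp : _ |- _ => apply: hyp end
    | apply: linear_lapp ]
  end).

(** * Tuple operations, multilinearity and the diagonal coaction *)

Section Tuples.
Variables (k : fieldType) (H : hopf_algebra k) (A : comodule_algebra H).

Lemma mul_at0 n a b (s : n.-tuple A) :
  mul_at 0 (cons_tuple a (cons_tuple b s)) = cons_tuple (a * b) s.
Proof.
apply: eq_from_tnth => i; rewrite tnth_mktuple !(tnth_nth 0) /=.
by case: (nat_of_ord i).
Qed.

Lemma mul_atS n i a (s : n.+1.-tuple A) :
  mul_at i.+1 (cons_tuple a s) = cons_tuple a (mul_at i s).
Proof.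
apply: eq_from_tnth => j; rewrite tnth_mktuple.
case: (unliftP ord0 j) => [j'|] -> /=; last by rewrite tnth0.
by rewrite tnthS tnth_mktuple.
Qed.

Lemma insert10 n a (s : n.-tuple A) :
  insert1 0 (cons_tuple a s) = cons_tuple a (cons_tuple 1 s).
Proof.
apply: eq_from_tnth => i; rewrite tnth_mktuple !(tnth_nth 0) /=.
by case: (nat_of_ord i) => [|[|j]].
Qed.

Lemma insert1S n i a (s : n.-tuple A) :
  insert1 i.+1 (cons_tuple a s) = cons_tuple a (insert1 i s).
Proof.
apply: eq_from_tnth => j; rewrite tnth_mktuple.
case: (unliftP ord0 j) => [j'|] -> /=; last by rewrite tnth0.
rewrite tnthS tnth_mktuple /= /bump /= add1n ltnS eqSS.
case: leqP => // ij; case: eqP => // _.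
by case: (nat_of_ord j') ij.
Qed.

Lemma rotate_rcons n a b (s : n.-tuple A) :
  rotate a (rcons_tuple s b) = cons_tuple a s.
Proof.
apply: eq_from_tnth => j; rewrite tnth_mktuple.
case: (unliftP ord0 j) => [j'|] -> /=; last by rewrite tnth0.
by rewrite tnthS (tnth_nth 0) nth_rcons size_tuple ltn_ord.
Qed.

Lemma nth_rcons_tuple n (s : n.-tuple A) b : (rcons_tuple s b)`_n = b.
Proof. by rewrite nth_rcons size_tuple ltnn eqxx. Qed.

Lemma rcons_tupleP n (t : n.+1.-tuple A) :
  exists (s : n.-tuple A) b, t = rcons_tuple s b.
Proof.
case: t => t; case/lastP: t => // s b st.
have sn : size s == n by rewrite size_rcons in st.
by exists (Tuple sn), b; apply: val_inj.
Qed.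

Lemma multilinear_cons (W : lmodType k) n (K : n.+1.-tuple A -> W) :
  (forall s, linear (fun a => K (cons_tuple a s))) ->
  (forall a, multilinear (fun s => K (cons_tuple a s))) -> multilinear K.
Proof.
move=> Kl Km t i; case: (tupleP t) => a s.
case: (unliftP ord0 i) => [j|] -> c x y; last by rewrite !tuple_upd0 Kl.
by rewrite -!cons_tuple_upd (Km a).
Qed.

Lemma multilinear_head (W : lmodType k) n (K : n.+1.-tuple A -> W) s :
  multilinear K -> linear (fun a => K (cons_tuple a s)).
Proof.
move=> Km c x y.
by have := Km (cons_tuple 0 s) ord0 c x y; rewrite !tuple_upd0.
Qed.

Lemma multilinear_tail (W : lmodType k) n (K : n.+1.-tuple A -> W) a :
  multilinear K -> multilinear (fun s => K (cons_tuple a s)).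
Proof. by move=> Km s i c x y; rewrite !cons_tuple_upd Km. Qed.

Lemma multilinear_rcons (W : lmodType k) n (K : n.+1.-tuple A -> W) :
  (forall b, multilinear (fun s => K (rcons_tuple s b))) ->
  (forall s, linear (fun b => K (rcons_tuple s b))) -> multilinear K.
Proof.
move=> Km Kl t i; have [s [b ->]] := rcons_tupleP t.
have [ni|in_] := leqP n i => c x y.
  have E z : tuple_upd (rcons_tuple s b) i z = rcons_tuple s z.
    apply: eq_from_tnth => j; rewrite tnth_mktuple -val_eqE /=.
    rewrite !(tnth_nth 0) /= !nth_rcons size_tuple.
    have jn := ltn_ord j; have iltn := ltn_ord i.
    case: (j =P i :> nat) => [->|ji]; first by rewrite ltnNge ni /= ifT //; lia.
    by have -> : (j < n)%N by lia.
  by rewrite !E Kl.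
have E z : tuple_upd (rcons_tuple s b) i z =
    rcons_tuple (tuple_upd s (Ordinal in_) z) b.
  apply: eq_from_tnth => j; rewrite tnth_mktuple -val_eqE /=.
  rewrite !(tnth_nth 0) /= !nth_rcons !size_tuple card_ord.
  case: (ltnP j n) => [jn|nj].
    by rewrite (nth_mktuple _ _ (Ordinal jn)) -val_eqE (tnth_nth 0).
  by rewrite ifF //; apply/negbTE; lia.
by rewrite !E (Km b).
Qed.

Lemma multilinear_mul_at (W : lmodType k) n i (K : n.-tuple A -> W) :
  (i < n)%N -> multilinear K ->
  multilinear (fun t : n.+1.-tuple A => K (mul_at i t)).
Proof.
elim: i n K => [|i IHi] [|n] K //= lin Km; apply: multilinear_cons => [t|a].
- case: (tupleP t) => b s c x y.
  by rewrite !mul_at0 mulrDl -scalerAl (multilinear_head _ Km).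
- apply: multilinear_cons => [s c x y|b s j c x y].
    by rewrite !mul_at0 mulrDr -scalerAr (multilinear_head _ Km).
  by rewrite !mul_at0 (multilinear_tail _ Km).
- by move=> c x y; rewrite !mul_atS (multilinear_head _ Km).
move=> s j c x y; rewrite !mul_atS.
exact: (IHi _ _ lin (multilinear_tail a Km)).
Qed.

Lemma multilinear_insert1 (W : lmodType k) n i (K : n.+2.-tuple A -> W) :
  (i <= n)%N -> multilinear K ->
  multilinear (fun t : n.+1.-tuple A => K (insert1 i t)).
Proof.
elim: i n K => [|i IHi] [|n] K //= lin Km; apply: multilinear_cons => [t|a].
1,3,5: by move=> c x y; rewrite ?insert10 ?insert1S (multilinear_head _ Km).
1,2: move=> s j c x y; rewrite !insert10.
1,2: exact: (multilinear_tail _ (multilinear_tail a Km)).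
move=> s j c x y; rewrite !insert1S.
exact: (IHi _ _ lin (multilinear_tail a Km)).
Qed.

Lemma diag_sweedler_cons (W : lmodType k) n a (s : n.-tuple A)
    (K : H -> n.+1.-tuple A -> W) :
  diag_sweedler (cons_tuple a s) K =
  \sw_(h, b <- acoact a)
    diag_sweedler s (fun g s' => K (h * g) (cons_tuple b s')).
Proof.
rewrite /= theadE.
by have -> : behead_tuple (cons_tuple a s) = s by exact: val_inj.
Qed.

Lemma exchange_diag_sweedler (U V W : lmodType k) n (t : n.-tuple A)
    (x : tensor U V) (F : H -> n.-tuple A -> U -> V -> W) :
  diag_sweedler t (fun h s => \sw_(u, v <- x) F h s u v) =
  \sw_(u, v <- x) diag_sweedler t (fun h s => F h s u v).
Proof.
elim: n t F => [|n IHn] t F //.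
case: (tupleP t) => a s; rewrite diag_sweedler_cons.
under [RHS]eq_sweedler => u v do rewrite diag_sweedler_cons.
rewrite exchange_sweedler; apply: eq_sweedler => h b.
exact: IHn.
Qed.

Lemma linear_diag_sweedler (W W' : lmodType k) (L : W -> W') n (t : n.-tuple A)
    (F : H -> n.-tuple A -> W) : linear L ->
  L (diag_sweedler t F) = diag_sweedler t (fun h s => L (F h s)).
Proof.
move=> Ll; elim: n t F => [|n IHn] t F //.
case: (tupleP t) => a s; rewrite !diag_sweedler_cons linear_sweedler //.
by apply: eq_sweedler => h b; rewrite IHn.
Qed.

(** [diag_sweedler] recurses on the first entry, whereas [tau] moves the last one; associativity of
    the product of legs splits the last leg off on the right. *)
Lemma diag_sweedler_rcons (W : lmodType k) n (s : n.-tuple A) b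
    (K : H -> n.+1.-tuple A -> W) :
  diag_sweedler (rcons_tuple s b) K =
  diag_sweedler s (fun g s' =>
    \sw_(h, c <- acoact b) K (g * h) (rcons_tuple s' c)).
Proof.
elim: n s K => [|n IHn] s K.
  rewrite (tuple0 s) /= [rcons_tuple _ _](_ : _ = cons_tuple b [tuple]);
    last exact: val_inj.
  rewrite theadE; apply: eq_sweedler => h c; rewrite mulr1 mul1r.
  by congr K; apply: val_inj.
case: (tupleP s) => a t.
have E (x c : A) (u : n.-tuple A) :
    rcons_tuple (cons_tuple x u) c = cons_tuple x (rcons_tuple u c).
  exact: val_inj.
rewrite E !diag_sweedler_cons; apply: eq_sweedler => h c.
rewrite IHn; apply: eq_diag_sweedler => g s'; apply: eq_sweedler => h' c'.
by rewrite mulrA E.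
Qed.

Lemma pair_bilinear_diag_sweedler (W : lmodType k) n (s : n.-tuple A)
    (K : H -> n.+1.-tuple A -> W) :
  (forall s, linear (K^~ s)) -> (forall h, multilinear (K h)) ->
  pair_bilinear (fun p : H * A =>
    diag_sweedler s (fun g s' => K (p.1 * g) (cons_tuple p.2 s'))).
Proof.
move=> Kl Km; split=> [a|h] c x y; rewrite -diag_sweedler_body;
  apply: eq_diag_sweedler => g s' /=; first by rewrite mulrDl -scalerAl Kl.
by rewrite (multilinear_head s' (Km _)).
Qed.

(** Colinearity of the multiplication of adjacent entries: at the head it is [acoactM], and the
    induction passes under the preceding legs. *)
Lemma diag_sweedler_mul_at (W : lmodType k) n i (t : n.+2.-tuple A)
    (K : H -> n.+1.-tuple A -> W) : (i <= n)%N ->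
  (forall s, linear (K^~ s)) -> (forall h, multilinear (K h)) ->
  diag_sweedler (mul_at i t) K = diag_sweedler t (fun h s => K h (mul_at i s)).
Proof.
elim: i n t K => [|i IHi] n t K lin Kl Km; case: (tupleP t) => a t1.
  case: (tupleP t1) => b s; have Kb s' := pair_bilinear_diag_sweedler s' Kl Km.
  rewrite mul_at0 !diag_sweedler_cons acoactM.
  rewrite (linear_sweedler _ _ (sweedler_linear (Kb s))).
  apply: eq_sweedler => g a0; rewrite diag_sweedler_cons.
  rewrite (linear_sweedler _ _ (sweedler_linear (Kb s))).
  apply: eq_sweedler => h b0; rewrite sweedler_tens //.
  by apply: eq_diag_sweedler => h' s'; rewrite mul_at0 mulrA.
case: n t1 K lin Kl Km {t} => // n t K lin Kl Km.
rewrite mul_atS !diag_sweedler_cons; apply: eq_sweedler => h b.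
rewrite IHi //; last by move=> g; exact: (multilinear_tail b (Km _)).
  by apply: eq_diag_sweedler => g s; rewrite mul_atS.
by move=> s c x y; rewrite mulrDr -scalerAr Kl.
Qed.

(** Colinearity of the insertion of a unit, which comes from [acoact1]. *)
Lemma diag_sweedler_insert1 (W : lmodType k) n i (t : n.+1.-tuple A)
    (K : H -> n.+2.-tuple A -> W) : (i <= n)%N ->
  (forall s, linear (K^~ s)) -> (forall h, multilinear (K h)) ->
  diag_sweedler (insert1 i t) K =
  diag_sweedler t (fun h s => K h (insert1 i s)).
Proof.
elim: i n t K => [|i IHi] n t K lin Kl Km; case: (tupleP t) => a s.
  rewrite insert10 !diag_sweedler_cons; apply: eq_sweedler => h b.
  rewrite diag_sweedler_cons acoact1 sweedler_tens /=.
    by apply: eq_diag_sweedler => g s'; rewrite insert10 mul1r.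
  apply: (@pair_bilinear_diag_sweedler _ _ _
    (fun g s' => K (h * g) (cons_tuple b s'))).
    by move=> s' c x y; rewrite mulrDr -scalerAr Kl.
  by move=> g; exact: multilinear_tail.
case: n s K lin Kl Km {t} => // n s K lin Kl Km.
rewrite insert1S !diag_sweedler_cons; apply: eq_sweedler => h b.
rewrite IHi //; last by move=> g; exact: (multilinear_tail b (Km _)).
  by apply: eq_diag_sweedler => g s'; rewrite insert1S.
by move=> s' c x y; rewrite mulrDr -scalerAr Kl.
Qed.

End Tuples.

(** * Simplicial identities at the level of tuples *)

Section TupleRelations.
Variables (k : fieldType) (H : hopf_algebra k) (A : comodule_algebra H).

Lemma mul_at_mul_at n i j (t : n.+2.-tuple A) : (i <= j < n)%N ->
  mul_at i (mul_at j.+1 t) = mul_at j (mul_at i t).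
Proof.
elim: n i j t => [|n IHn] i j t; first by rewrite andbF.
case: (tupleP t) => a t1; case: i => [|i]; case: j => [|j] // lij.
- case: (tupleP t1) => b t2; case: (tupleP t2) => c s.
  by rewrite mul_atS !mul_at0 mulrA.
- by case: (tupleP t1) => b t2; rewrite !mul_atS !mul_at0 mul_atS.
by rewrite !mul_atS IHn.
Qed.

Lemma insert1_insert1 n i j (t : n.+1.-tuple A) : (i <= j <= n)%N ->
  insert1 i (insert1 j t) = insert1 j.+1 (insert1 i t).
Proof.
elim: i n j t => [|i IHi] n j t; case: (tupleP t) => a s.
  by case: j => [|j] _; rewrite ?insert1S !insert10 !insert1S ?insert10.
case: j => // j; case: n s {t} => [|n] s; first by rewrite andbF.
by move=> lij; rewrite !insert1S IHi.
Qed.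

Lemma mul_at_insert1_lt n i j (t : n.+2.-tuple A) : (i <= j <= n)%N ->
  mul_at i (insert1 j.+1 t) = insert1 j (mul_at i t).
Proof.
elim: i n j t => [|i IHi] n j t; case: (tupleP t) => a s.
  rewrite insert1S; case: (tupleP s) => b u.
  by case: j => [|j] _;
    rewrite ?insert10 ?insert1S !mul_at0 ?insert10 ?insert1S.
case: j => // j; case: n s {t} => [|n] s; first by rewrite andbF.
by move=> lij; rewrite insert1S !mul_atS insert1S IHi.
Qed.

Lemma mul_at_insert1_id n i (t : n.+1.-tuple A) : (i <= n)%N ->
  mul_at i (insert1 i t) = t.
Proof.
elim: i n t => [|i IHi] n t; case: (tupleP t) => a s.
  by rewrite insert10 mul_at0 mulr1.
case: n s {t} => // n s lin.
by rewrite insert1S mul_atS IHi.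
Qed.

Lemma mul_at_insert1_succ n i (t : n.+1.-tuple A) : (i < n)%N ->
  mul_at i.+1 (insert1 i t) = t.
Proof.
elim: i n t => [|i IHi] [|n] // t; case: (tupleP t) => a s lin.
  by case: (tupleP s) => b u; rewrite insert10 mul_atS mul_at0 mul1r.
by rewrite insert1S mul_atS IHi.
Qed.

Lemma mul_at_insert1_gt n i j (t : n.+2.-tuple A) : (j < i <= n)%N ->
  mul_at i.+1 (insert1 j t) = insert1 j (mul_at i t).
Proof.
elim: j n i t => [|j IHj] n [|i] // t; case: (tupleP t) => a s.
  by rewrite insert10 !mul_atS insert10.
case: n s {t} => [|n] s; first by rewrite andbF.
by move=> lij; rewrite insert1S !mul_atS insert1S IHj.
Qed.

Lemma cons_rcons_tuple n (a b : A) (s : n.-tuple A) :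
  rcons_tuple (cons_tuple a s) b = cons_tuple a (rcons_tuple s b).
Proof. exact: val_inj. Qed.

Lemma mul_at_rcons n i (s : n.+1.-tuple A) b : (i < n)%N ->
  mul_at i (rcons_tuple s b) = rcons_tuple (mul_at i s) b.
Proof.
elim: i n s => [|i IHi] [|n] // s lin; case: (tupleP s) => a t.
  by case: (tupleP t) => c u;
    rewrite !cons_rcons_tuple !mul_at0 cons_rcons_tuple.
by rewrite cons_rcons_tuple !mul_atS IHi // cons_rcons_tuple.
Qed.

Lemma mul_at_last n (s : n.-tuple A) a b :
  mul_at n (rcons_tuple (rcons_tuple s a) b) = rcons_tuple s (a * b).
Proof.
elim: n s => [|n IHn] s.
  rewrite [rcons_tuple _ _](_ : _ = cons_tuple a (cons_tuple b s)).
    by rewrite mul_at0; apply: val_inj; rewrite /= tuple0.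
  by apply: val_inj; rewrite /= tuple0.
by case: (tupleP s) => c u; rewrite !cons_rcons_tuple mul_atS IHn.
Qed.

Lemma insert1_rcons n i (s : n.-tuple A) b : (i < n)%N ->
  insert1 i (rcons_tuple s b) = rcons_tuple (insert1 i s) b.
Proof.
elim: i n s => [|i IHi] [|n] // s lin; case: (tupleP s) => a t;
  rewrite cons_rcons_tuple ?insert10 ?insert1S ?IHi //;
  by rewrite !cons_rcons_tuple.
Qed.

Lemma insert1_last n (t : n.+1.-tuple A) : insert1 n t = rcons_tuple t 1.
Proof.
elim: n t => [|n IHn] t; case: (tupleP t) => a s.
  by rewrite insert10; apply: val_inj; rewrite /= (tuple0 s).
by rewrite insert1S IHn cons_rcons_tuple.
Qed.

Lemma mul_front_rotate n b (t : n.+2.-tuple A) :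
  mul_front b t = mul_at 0 (rotate b t).
Proof.
have [s [c ->]] := rcons_tupleP t; rewrite rotate_rcons.
case: (tupleP s) => a u; rewrite mul_at0 cons_rcons_tuple.
apply: eq_from_tnth => i; rewrite tnth_mktuple !(tnth_nth 0) /=.
case: i => [[|i] lin] //=.
by rewrite nth_rcons size_tuple -ltnS lin.
Qed.

(* Lets concatenations of tuples be typed without casts. *)
Definition seq_tuple n (l : seq A) : n.-tuple A := [tuple l`_i | i < n].

Lemma seq_tupleE n (t : n.-tuple A) : seq_tuple n t = t.
Proof. by apply: eq_from_tnth => i; rewrite tnth_mktuple (tnth_nth 0). Qed.

Lemma seq_tuple_cons n a l :
  seq_tuple n.+1 (a :: l) = cons_tuple a (seq_tuple n l).
Proof.
apply: eq_from_tnth => j; rewrite tnth_mktuple.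
case: (unliftP ord0 j) => [j'|] -> /=; last by rewrite tnth0.
by rewrite tnthS tnth_mktuple.
Qed.

Lemma seq_tuple_rcons n l a : size l = n ->
  seq_tuple n.+1 (rcons l a) = rcons_tuple (seq_tuple n l) a.
Proof.
elim: n l => [|n IHn] [|b l] // sl.
  by rewrite seq_tuple_cons (tuple0 (seq_tuple 0 _)); apply: val_inj.
case: sl => sl; rewrite rcons_cons.
by rewrite !seq_tuple_cons IHn // cons_rcons_tuple.
Qed.

End TupleRelations.

(** * Operators on colinear maps; precomposition with tuple maps *)

Section Operators.
Variables (k : fieldType) (H : hopf_algebra k).
Variables (A : comodule_algebra H) (M : module_comodule H).

Lemma sweedler_tcoact_pure (W : lmodType k) n (t : n.-tuple A)
    (F : H -> tpow A n -> W) : pair_bilinear (fun p => F p.1 p.2) ->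
  \sw_(h, y <- tcoact (pure t)) F h y =
  diag_sweedler t (fun h s => F h (pure s)).
Proof.
move=> Fb; rewrite tcoact_pure (linear_diag_sweedler _ _ (sweedler_linear Fb)).
by apply: eq_diag_sweedler => h s; rewrite sweedler_tens.
Qed.

Lemma sweedler_mcoact_homH (W : lmodType k) n (f : homH A M n) t
    (F : H -> M -> W) : pair_bilinear (fun p => F p.1 p.2) ->
  \sw_(h, m <- mcoact (val f (pure t))) F h m =
  diag_sweedler t (fun h s => F h (val f (pure s))).
Proof.
move=> Fb; rewrite homH_colinear (linear_sweedler _ _ (sweedler_linear Fb)).
under eq_sweedler do rewrite sweedler_tens //.
apply: (@sweedler_tcoact_pure _ _ _ (fun h y => F h (val f y))).
have [Fl Fr] := Fb; split=> [y|h] c x z /=; first exact: Fl.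
by rewrite homH_linear; exact: Fr.
Qed.

Lemma homH_eq n (f g : homH A M n) :
  (forall t, val f (pure t) = val g (pure t)) -> f = g.
Proof.
move=> fg; apply: val_inj; apply/funext.
by apply: uext_unique; [exact: homH_linear | exact: homH_linear | exact: fg].
Qed.

(** The representative of [x] is fixed, so the sum is linear in the function; this makes [tau_fun]
    linear in the cochain. *)
Lemma uext_body (W : lmodType k) n (F G : n.-tuple A -> W) c x :
  uext (fun t => c *: F t + G t) x =
  c *: uext (P := @multilinear k A n) F x + uext G x.
Proof.
rewrite /uext /fsum scaler_sumr -big_split; apply: eq_bigr => p _ /=.
by rewrite scalerDr !scalerA mulrC.
Qed.

(** Both sides of the colinearity equation are linear in [x], so pure tensors suffice. *)
Lemma hom_predP n (phi : tpow A n.+1 -> M) : linear phi ->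
  (forall t, mcoact (phi (pure t)) =
    diag_sweedler t (fun h s => h ⊗ phi (pure s))) ->
  hom_pred phi.
Proof.
move=> phil phic; apply/asboolP; split=> // x.
have Fb : pair_bilinear (fun p : H * tpow A n.+1 => p.1 ⊗ phi p.2).
  split=> [y|h] c u v /=; first exact: tens_linearl.
  by rewrite phil; exact: tens_linearr.
move: x; apply: uext_unique => [c u v|c u v|t].
- by rewrite phil linearP.
- by rewrite tcoact_linear; exact: (sweedler_linear Fb).
by rewrite phic (sweedler_tcoact_pure _ Fb).
Qed.

Section Lift.
Variables (m n : nat) (T : (tpow A m.+1 -> M) -> (tpow A n.+1 -> M)).
Hypothesis T_hom : forall f : homH A M m, hom_pred (T (val f)).

(** The linearity proof is a parameter of the term, so that the instance below can be inferred from
    it. *)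
Definition hom_lift (_ : linear T) (f : homH A M m) : homH A M n :=
  Sub (T (val f)) (T_hom f).

Lemma hom_lift_linear (Tl : linear T) : linear (hom_lift Tl).
Proof. by move=> c f g; apply: val_inj; rewrite /= Tl. Qed.
HB.instance Definition _ (Tl : linear T) :=
  GRing.isLinear.Build k (homH A M m) (homH A M n) *:%R (hom_lift Tl)
    (hom_lift_linear Tl).

End Lift.

Section Substitution.
Variables (m n : nat) (g : n.+1.-tuple A -> m.+1.-tuple A).
Hypothesis g_multilinear : forall (W : lmodType k) (K : m.+1.-tuple A -> W),
  multilinear K -> multilinear (fun t => K (g t)).
Hypothesis g_diag : forall (W : lmodType k) t (K : H -> m.+1.-tuple A -> W),
  (forall s, linear (K^~ s)) -> (forall h, multilinear (K h)) ->
  diag_sweedler (g t) K = diag_sweedler t (fun h s => K h (g s)).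

(** [g_multilinear] makes this map linear and [g_diag] makes it colinear, so precomposition with it
    preserves colinear maps. *)
Definition subst_tpow : tpow A n.+1 -> tpow A m.+1 :=
  uext (fun t => pure (g t)).

Definition subst_fun (phi : tpow A m.+1 -> M) : tpow A n.+1 -> M :=
  fun x => phi (subst_tpow x).

Lemma subst_tpow_pure t : subst_tpow (pure t) = pure (g t).
Proof. exact/uext_gen/g_multilinear/pure_multilinear. Qed.

Lemma subst_fun_linear : linear subst_fun.
Proof. by []. Qed.

Lemma subst_fun_hom (f : homH A M m) : hom_pred (subst_fun (val f)).
Proof.
apply: hom_predP => [c x y|t].
  have sl := uext_linear (g_multilinear (@pure_multilinear k A m.+1)).
  by rewrite /subst_fun /subst_tpow sl homH_linear.
under eq_diag_sweedler do rewrite /subst_fun subst_tpow_pure.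
rewrite /subst_fun subst_tpow_pure homH_colinear sweedler_tcoact_pure;
  last by solve_linear.
apply: (@g_diag _ _ (fun h s => h ⊗ val f (pure s))) => [s|h];
  first by solve_linear.
by move=> s i c x y; rewrite pure_multilinear homH_linear tens_linearr.
Qed.

Definition subst_hom : {linear homH A M m -> homH A M n} :=
  hom_lift subst_fun_hom subst_fun_linear.

Lemma subst_homE f t : val (subst_hom f) (pure t) = val f (pure (g t)).
Proof. by rewrite /= /subst_fun subst_tpow_pure. Qed.


End Substitution.

End Operators.

(** * Cancellation of the antipode *)

Section AntipodeCancellation.
Variables (k : fieldType) (H : hopf_algebra k) (A : comodule_algebra H).

Lemma acoact_coassoc (W : lmodType k) x (F : H -> H -> A -> W) :
  (forall h v, linear (fun g => F g h v)) ->
  (forall g v, linear (fun h => F g h v)) ->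
  (forall g h, linear (F g h)) ->
  \sw_(h, v <- acoact x) \sw_(h1, h2 <- comul h) F h1 h2 v =
  \sw_(h, v <- acoact x) \sw_(g, w <- acoact v) F h g w.
Proof.
by have [rl rc _] := acoactP A; exact: (sweedler_coassoc _ rc rl).
Qed.

(* By coassociativity [h3 ⊗ g] is the coproduct of a single coaction leg, so  *)
(* the antipode axiom applies to it.                                          *)
Lemma sweedler_antipode_cancel (W : lmodType k) b (F : H -> H -> H -> A -> W) :
  (forall h2 r a, linear (fun h1 => F h1 h2 r a)) ->
  (forall h1 r a, linear (fun h2 => F h1 h2 r a)) ->
  (forall h1 h2 a, linear (fun r => F h1 h2 r a)) ->
  (forall h1 h2 r, linear (F h1 h2 r)) ->
  \sw_(h, a <- acoact b) \sw_(h1, h' <- comul h) \sw_(h2, h3 <- comul h')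
    \sw_(g, a' <- acoact a) F h1 h2 (antipode h3 * g) a' =
  \sw_(h1, a <- acoact b) \sw_(h2, a' <- acoact a) F h1 h2 1 a'.
Proof.
move=> F1 F2 F3 F4.
(* Slotwise linearity closed under precomposition: the form in which [solve_linear] can use it as a
   hypothesis. *)
have G1 (V : lmodType k) (L : V -> H) h2 r a :
  linear L -> linear (fun x => F (L x) h2 r a).
  by move=> Ll c x y; rewrite Ll F1.
have G2 (V : lmodType k) (L : V -> H) h1 r a :
  linear L -> linear (fun x => F h1 (L x) r a).
  by move=> Ll c x y; rewrite Ll F2.
have G3 (V : lmodType k) (L : V -> H) h1 h2 a :
  linear L -> linear (fun x => F h1 h2 (L x) a).
  by move=> Ll c x y; rewrite Ll F3.
have G4 (V : lmodType k) (L : V -> A) h1 h2 r :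
  linear L -> linear (fun x => F h1 h2 r (L x)).
  by move=> Ll c x y; rewrite Ll F4.
rewrite (@acoact_coassoc _ _ (fun h1 h' a => \sw_(h2, h3 <- comul h')
  \sw_(g, a' <- acoact a) F h1 h2 (antipode h3 * g) a')); [|by solve_linear..].
apply: eq_sweedler => h1 a.
rewrite (@acoact_coassoc _ _ (fun h2 h3 a =>
  \sw_(g, a' <- acoact a) F h1 h2 (antipode h3 * g) a')); [|by solve_linear..].
apply: eq_sweedler => h2 a1.
rewrite -(@acoact_coassoc _ _ (fun h3 g a =>
  F h1 h2 (antipode h3 * g) a)); [|by solve_linear..].
(* The antipode axiom yields a scalar [counit h]; the counit law produces the same scalar on the
   right. *)
have [_ _ counit_law] := acoactP A; rewrite -[in RHS](counit_law a1).
rewrite (linear_sweedler _ _ (F4 h1 h2 1)); apply: eq_sweedler => h a2.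
rewrite -(@linear_sweedler _ _ _ _ _ (fun r => F h1 h2 r a2)) //.
by rewrite antipodel (scalable_linear (F3 _ _ _)) (scalable_linear (F4 _ _ _)).
Qed.
End AntipodeCancellation.

(** * The cyclic operator and the cofaces built from it *)

Section CyclicOperator.
Variables (k : fieldType) (H : hopf_algebra k).
Variables (A : comodule_algebra H) (M : module_comodule H).

Definition tau_body n (phi : tpow A n.+1 -> M) (t : n.+1.-tuple A) : M :=
  \sw_(h, b <- acoact t`_n) (phi (pure (rotate b t)) ◁ h).

Definition tau_fun n (phi : tpow A n.+1 -> M) : tpow A n.+1 -> M :=
  uext (tau_body phi).

Lemma tau_body_rcons n (phi : tpow A n.+1 -> M) s c :
  tau_body phi (rcons_tuple s c) =
  \sw_(h, b <- acoact c) (phi (pure (cons_tuple b s)) ◁ h).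
Proof.
rewrite /tau_body nth_rcons_tuple.
by apply: eq_sweedler => h b; rewrite rotate_rcons.
Qed.

Lemma multilinear_tau_body n (f : homH A M n) : multilinear (tau_body (val f)).
Proof.
apply: multilinear_rcons => [b s i c x y|s c x y]; rewrite !tau_body_rcons.
  rewrite -sweedler_body; apply: eq_sweedler => h a.
  by rewrite !cons_tuple_upd pure_multilinear homH_linear linearPl.
move: c x y.
apply: (@linear_sweedler_arg _ _ _ _ _ (fun c => acoact c));
  first by solve_linear.
by solve_linear.
Qed.

Lemma tau_fun_pure n (f : homH A M n) t :
  tau_fun (val f) (pure t) =
  \sw_(h, b <- acoact t`_n) (val f (pure (rotate b t)) ◁ h).
Proof. exact/uext_gen/multilinear_tau_body. Qed.

Lemma tau_fun_rcons n (f : homH A M n) s c :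
  tau_fun (val f) (pure (rcons_tuple s c)) =
  \sw_(h, b <- acoact c) (val f (pure (cons_tuple b s)) ◁ h).
Proof. by rewrite tau_fun_pure -tau_body_rcons. Qed.

Lemma tau_fun_linear n : linear (@tau_fun n).
Proof.
move=> c f g; apply/funext => x.
rewrite /tau_fun -[RHS]uext_body; congr fsum; apply/funext => t.
rewrite /tau_body -sweedler_body; apply: eq_sweedler => h b.
exact: linearPl.
Qed.

Hypothesis M_SAYD : SAYD A M.

(* Condition (i) leaves [S(b_(-1)^(3)) b_(0)(-1)] in front of the coaction legs *)
(* of the other entries, and that factor cancels.                             *)
Lemma tau_fun_hom n (f : homH A M n) : hom_pred (tau_fun (val f)).
Proof.
apply: hom_predP; first exact/uext_linear/multilinear_tau_body.
move=> t; have [s [b ->]] := rcons_tupleP t.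
rewrite tau_fun_rcons.
have [eqv _] := M_SAYD f; rewrite eqv {eqv}.
(* Colinearity of [f] splits the coaction of its value into that of [a0] and the diagonal one of
   [s]; the latter sum is moved outside all legs of [b]. *)
under eq_sweedler => h a0.
  under eq_sweedler => h1 h'.
    under eq_sweedler => h2 h3.
      rewrite (@sweedler_mcoact_homH _ _ _ _ _ _ f (cons_tuple a0 s)
        (fun g m => (antipode h3 * g * h1) ⊗ (m ◁ h2)));
        last by solve_linear.
      rewrite diag_sweedler_cons.
      under eq_sweedler do under eq_diag_sweedler do rewrite mulrA.
      rewrite -exchange_diag_sweedler.
      over.
    rewrite -exchange_diag_sweedler.
    over.
  rewrite -exchange_diag_sweedler.
  over.
(* On the right the legs of [s] are outermost too, so the two sides are compared leg by leg. *)
rewrite -exchange_diag_sweedler diag_sweedler_rcons.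
apply: eq_diag_sweedler => g s'.
rewrite (@sweedler_antipode_cancel _ _ _ _ _ (fun h1 h2 r a1 =>
  (r * g * h1) ⊗ (val f (pure (cons_tuple a1 s')) ◁ h2)));
  [|by solve_linear..].
apply: eq_sweedler => h c; rewrite tau_fun_rcons.
rewrite (linear_sweedler _ _ (tens_linearr _)).
by apply: eq_sweedler => h' c'; rewrite mul1r.
Qed.

Definition tau_hom n : {linear homH A M n -> homH A M n} :=
  hom_lift (@tau_fun_hom n) (@tau_fun_linear n).

Lemma tau_homE n (f : homH A M n) t :
  val (tau_hom n f) (pure t) =
  \sw_(h, b <- acoact t`_n) (val f (pure (rotate b t)) ◁ h).
Proof. exact: tau_fun_pure. Qed.

Lemma tau_hom_rcons n (f : homH A M n) s c :
  val (tau_hom n f) (pure (rcons_tuple s c)) =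
  \sw_(h, b <- acoact c) (val f (pure (cons_tuple b s)) ◁ h).
Proof. exact: tau_fun_rcons. Qed.

(* [minn i n] makes [face n i] and [degeneracy n i] total in [i]; only the    *)
(* values at [i <= n] matter.                                                 *)
Definition face n i : {linear homH A M n -> homH A M n.+1} :=
  subst_hom M
    (fun W K =>
      @multilinear_mul_at _ _ _ W n.+1 (minn i n) K (geq_minr i n))
    (fun W t K =>
      @diag_sweedler_mul_at _ _ _ W n (minn i n) t K (geq_minr i n)).

Definition degeneracy n i : {linear homH A M n.+1 -> homH A M n} :=
  subst_hom M
    (fun W K => @multilinear_insert1 _ _ _ W n (minn i n) K (geq_minr i n))
    (fun W t K =>
      @diag_sweedler_insert1 _ _ _ W n (minn i n) t K (geq_minr i n)).

(** Taking tau delta_0 as the last coface gives its colinearity at once; [coface_lastE] recovers the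
    formula with [mul_front]. *)
Definition coface n i : {linear homH A M n -> homH A M n.+1} :=
  if (i <= n)%N then face n i else tau_hom n.+1 \o face n 0.

Lemma cofaceE n i (f : homH A M n) t : (i <= n)%N ->
  val (coface n i f) (pure t) = val f (pure (mul_at i t)).
Proof.
move=> lin; rewrite /coface lin subst_homE.
by rewrite (minn_idPl lin).
Qed.

Lemma coface_last n (f : homH A M n) :
  coface n n.+1 f = tau_hom n.+1 (coface n 0 f).
Proof. by rewrite /coface ltnn. Qed.

Lemma degeneracyE n i (f : homH A M n.+1) t : (i <= n)%N ->
  val (degeneracy n i f) (pure t) = val f (pure (insert1 i t)).
Proof. by move=> lin; rewrite subst_homE (minn_idPl lin). Qed.

(** * The cocyclic relations *)

Lemma tau_coface0 n (f : homH A M n) :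
  tau_hom n.+1 (coface n 0 f) = coface n n.+1 f.
Proof. by rewrite coface_last. Qed.

Lemma coface_lastE n (f : homH A M n) t :
  val (coface n n.+1 f) (pure t) =
  \sw_(h, b <- acoact t`_n.+1) (val f (pure (mul_front b t)) ◁ h).
Proof.
rewrite coface_last tau_homE; apply: eq_sweedler => h b.
by rewrite cofaceE // mul_front_rotate.
Qed.

Lemma coface_coface_lt n i j (f : homH A M n) : (i < j <= n.+1)%N ->
  coface n.+1 j (coface n i f) = coface n.+1 i (coface n j.-1 f).
Proof.
case: j => // j /andP[lij ljn]; apply: homH_eq => t.
by rewrite !cofaceE ?mul_at_mul_at //; lia.
Qed.

(** On [s ⊗ a ⊗ b] both sides are [f(a_(0) b_(0) ⊗ s)] acted on by [a_(-1) b_(-1)], in one step on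
    the right and in two on the left. *)
Lemma tau_tau_coface0 n (f : homH A M n) :
  tau_hom n.+1 (coface n n.+1 f) = coface n n (tau_hom n f).
Proof.
apply: homH_eq => t; have [t' [b ->]] := rcons_tupleP t.
have [s [a ->]] := rcons_tupleP t'.
rewrite cofaceE // mul_at_last !tau_hom_rcons acoactM.
have Fb : pair_bilinear (fun p : H * A =>
  val f (pure (cons_tuple p.2 s)) ◁ p.1) by solve_linear.
rewrite (linear_sweedler _ _ (sweedler_linear Fb)).
under [RHS]eq_sweedler => g a0.
  rewrite (linear_sweedler _ _ (sweedler_linear Fb)).
  under eq_sweedler => h b0 do rewrite sweedler_tens //= actM.
  over.
rewrite exchange_sweedler; apply: eq_sweedler => h b0.
rewrite coface_last -cons_rcons_tuple tau_hom_rcons.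
rewrite (linear_sweedler _ _ (fun c x y => linearPl _ h c x y)).
by apply: eq_sweedler => g a0; rewrite cofaceE // mul_at0.
Qed.

Lemma tau_coface n i (f : homH A M n) : (0 < i <= n.+1)%N ->
  tau_hom n.+1 (coface n i f) = coface n i.-1 (tau_hom n f).
Proof.
case: i => // i /=; rewrite ltnS leq_eqVlt => /orP[/eqP->|lin].
  exact: tau_tau_coface0.
apply: homH_eq => t; have [t' [b ->]] := rcons_tupleP t.
rewrite tau_hom_rcons cofaceE ?(ltnW lin) // mul_at_rcons // tau_hom_rcons.
by apply: eq_sweedler => h b0; rewrite cofaceE // mul_atS.
Qed.

Lemma coface_coface n i j (f : homH A M n) : (i < j <= n.+2)%N ->
  coface n.+1 j (coface n i f) = coface n.+1 i (coface n j.-1 f).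
Proof.
move=> /andP[lij]; rewrite leq_eqVlt => /orP[/eqP jn|]; last first.
  by move=> ljn; apply: coface_coface_lt; rewrite lij.
rewrite jn /= in lij *; rewrite !coface_last.
(* Reading [i] as the predecessor of [i.+1] pulls [tau] to the front, leaving a relation between two
   cofaces under it. *)
rewrite -[i in RHS]/(i.+1.-1) -tau_coface //.
move: lij; rewrite ltnS leq_eqVlt => /orP[/eqP->|lin].
  (* Here [i.+1] is again the last index, and both sides become tau tau delta_0 delta_0. *)
  by rewrite !coface_last -(@tau_coface _ 1) // (@coface_coface_lt _ 0 1).
by rewrite -(@coface_coface_lt _ 0 i.+1) //.
Qed.

Lemma degeneracy_degeneracy n i j (f : homH A M n.+2) : (i <= j <= n)%N ->
  degeneracy n j (degeneracy n.+1 i f) =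
  degeneracy n i (degeneracy n.+1 j.+1 f).
Proof.
move=> lij; apply: homH_eq => t.
have [ljn lin lin1] : [/\ j <= n, i <= n & i <= n.+1]%N by split; lia.
rewrite degeneracyE // degeneracyE // degeneracyE // degeneracyE //.
by rewrite insert1_insert1.
Qed.

Lemma tau_degeneracy n i (f : homH A M n.+1) : (0 < i <= n)%N ->
  tau_hom n (degeneracy n i f) = degeneracy n i.-1 (tau_hom n.+1 f).
Proof.
case: i => // i /= lin; apply: homH_eq => t.
have [s [b ->]] := rcons_tupleP t.
rewrite degeneracyE ?(ltnW lin) // insert1_rcons // !tau_hom_rcons.
by apply: eq_sweedler => h a; rewrite degeneracyE // insert1S.
Qed.

(** The coaction of 1 is [1 ⊗ 1], so [tau] rotates a final unit without a twist. *)
Lemma tau_hom_rcons1 n (f : homH A M n) s :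
  val (tau_hom n f) (pure (rcons_tuple s 1)) = val f (pure (cons_tuple 1 s)).
Proof.
by rewrite tau_hom_rcons acoact1 sweedler_tens ?act1 //; solve_linear.
Qed.

Lemma tau_degeneracy0 n (f : homH A M n.+1) :
  tau_hom n (degeneracy n 0 f) =
  degeneracy n n (tau_hom n.+1 (tau_hom n.+1 f)).
Proof.
apply: homH_eq => t; rewrite degeneracyE // insert1_last tau_hom_rcons1.
have [s [b ->]] := rcons_tupleP t.
rewrite -cons_rcons_tuple !tau_hom_rcons; apply: eq_sweedler => h a.
by rewrite degeneracyE // insert10.
Qed.

Lemma degeneracy_coface_lt n i j (f : homH A M n.+1) : (i < j <= n.+1)%N ->
  degeneracy n.+1 j (coface n.+1 i f) = coface n i (degeneracy n j.-1 f).
Proof.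
case: j => // j lij; apply: homH_eq => t.
rewrite degeneracyE ?cofaceE ?mul_at_insert1_lt; try lia.
by rewrite degeneracyE //; lia.
Qed.

Lemma degeneracy_coface_id n i j (f : homH A M n) :
  (j <= n)%N -> i = j \/ i = j.+1 -> degeneracy n j (coface n i f) = f.
Proof.
move=> ljn ij; apply: homH_eq => t; rewrite degeneracyE //.
case: ij => ->; first by rewrite cofaceE // mul_at_insert1_id.
move: ljn; rewrite leq_eqVlt => /orP[/eqP->|ljn].
  rewrite insert1_last coface_last tau_hom_rcons1 cofaceE //.
  by case: (tupleP t) => a s; rewrite mul_at0 mul1r.
by rewrite cofaceE // mul_at_insert1_succ.
Qed.

Lemma degeneracy_coface_gt n i j (f : homH A M n.+1) : (j.+1 < i <= n.+2)%N ->
  degeneracy n.+1 j (coface n.+1 i f) = coface n i.-1 (degeneracy n j f).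
Proof.
case: i => // i /=; rewrite !ltnS => /andP[lji].
rewrite leq_eqVlt => /orP[/eqP i_eq|lin].
  rewrite i_eq in lji *; rewrite !coface_last.
  (* The same index shift moves [tau] outside, which leaves the relation between sigma_(j+1) and
     delta_0. *)
  rewrite -[j in LHS]/(j.+1.-1) -tau_degeneracy //.
  by rewrite degeneracy_coface_lt.
apply: homH_eq => t; rewrite degeneracyE ?cofaceE //; try lia.
by rewrite degeneracyE ?mul_at_insert1_gt //; lia.
Qed.

(** After j steps the last j entries have passed to the front in their original order, and the
    product of their legs acts in that same order. *)
Lemma iter_tau_hom n (f : homH A M n) j (t : j.-tuple A) (s : seq A) :
  (size s + j = n.+1)%N ->
  val (iter j (tau_hom n) f) (pure (seq_tuple n.+1 (s ++ t))) =
  diag_sweedler t (fun h t' => val f (pure (seq_tuple n.+1 (t' ++ s))) ◁ h).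
Proof.
elim: j f t s => [|j IHj] f t s sz.
  by rewrite /= (tuple0 t) act1 cats0.
(* The induction hypothesis is used for the cochain [tau_hom n f], with [b] counted among the
   entries that stay; the remaining [tau] then moves [b]. *)
case: (tupleP t) => b u; rewrite diag_sweedler_cons iterSr /= -cat_rcons IHj;
  last by rewrite size_rcons; lia.
rewrite -exchange_diag_sweedler; apply: eq_diag_sweedler => g u'.
rewrite -rcons_cat seq_tuple_rcons ?size_cat ?size_tuple; last by lia.
rewrite tau_hom_rcons (linear_sweedler _ _ (fun c x y => linearPl _ g c x y)).
by apply: eq_sweedler => h c; rewrite -seq_tuple_cons actM.
Qed.

Lemma tau_hom_cyclic n (f : homH A M n) : iter n.+1 (tau_hom n) f = f.
Proof.
apply: homH_eq => t; rewrite -{1}[t]seq_tupleE -[X in seq_tuple _ X]cat0s.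
rewrite iter_tau_hom //; have [_ <-] := M_SAYD f.
rewrite sweedler_tcoact_pure; last by solve_linear.
by apply: eq_diag_sweedler => h s; rewrite cats0 seq_tupleE.
Qed.

End CyclicOperator.

Theorem proposition1p6 (k : fieldType) (H : hopf_algebra k)
    (M : module_comodule H) (A : comodule_algebra H) :
  SAYD A M -> HCC A M.
Proof.
move=> M_SAYD.
exists (CocyclicModule (coface_coface M_SAYD)
  (@degeneracy_degeneracy _ _ _ _) (degeneracy_coface_lt M_SAYD)
  (degeneracy_coface_id M_SAYD) (degeneracy_coface_gt M_SAYD)
  (tau_coface0 M_SAYD) (tau_coface M_SAYD) (tau_degeneracy0 M_SAYD)
  (tau_degeneracy M_SAYD) (tau_hom_cyclic M_SAYD)).
split.
- by move=> n i f t; exact: cofaceE.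
- by move=> n f t; exact: coface_lastE.
- by move=> n i f t; exact: degeneracyE.
by move=> n f t; exact: tau_homE.
Qed.
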